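(* Let $k,t\ge 0$ be integers, $n=2k+t+1$, and $\alpha\in[0,1]$. Let $C^c$ be the graph with vertices $v,v_1,\dots,v_k,v_1',\dots,v_k',u_1,\dots,u_t$ consisting of the $k$ triangles $vv_iv_i'v$ ($1\le i\le k$) and the $t$ pendant edges $vu_1,\dots,vu_t$. The eigenvalues of $A_\alpha(C^c)$ are $\alpha$, $\alpha+1$ (if $k\ge 2$, otherwise none), $3\alpha-1$, and the roots of $f(\lambda)=0$, where $$f(\lambda)=(\alpha-\lambda)^3+(n\alpha-2\alpha+1)(\alpha-\lambda)^2+\big[(1-n)\alpha^2+(3n-4)\alpha+1-n\big](\alpha-\lambda)-t(1-\alpha)^2.$$
   Context: All graphs are finite and simple. For a graph $G$, let $A(G)$ be its adjacency matrix and $D(G)$ the diagonal matrix of vertex degrees. For $\alpha\in[0,1]$, $A_\alpha(G)=\alpha D(G)+(1-\alpha)A(G)$.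
   Formalization: The printed list is wrong in general if k=0 or t≤1; it is proved as stated for k≥1, t≥2. For all k,t an exact list is proved: α only if t≥2, 3α−1 only if k≥1, and the root α of f (if t=0) or α+1 (if k=0) counts only when it is a multiple root of f. *)

(* Defs.v *)
From HB Require Import structures.
From mathcomp Require Import all_boot all_order all_algebra.
From mathcomp Require Import reals complex.
Set Implicit Arguments.
Unset Strict Implicit.
Unset Printing Implicit Defensive.
Import Order.TTheory GRing.Theory Num.Theory.
Local Open Scope ring_scope.

Record sgraph := SGraph {
  vertex :> finType;
  adj : rel vertex;
  adj_sym : symmetric adj;
  adj_irr : irreflexive adj
}.

Definition deg (G : sgraph) (x : G) : nat := #|[set y | adj x y]|.

(* Rows and columns are indexed by the vertices through [enum_val]. *)
Definition adj_mx (R : realType) (G : sgraph) : 'M[R]_#|G| :=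
  \matrix_(i, j) (adj (enum_val i) (enum_val j))%:R.

Definition deg_mx (R : realType) (G : sgraph) : 'M[R]_#|G| :=
  diag_mx (\row_i (deg (enum_val i))%:R).

Definition A_alpha (R : realType) (G : sgraph) (a : R) : 'M[R]_#|G| :=
  a *: deg_mx R G + (1 - a) *: adj_mx R G.

(* [None] is the hub v; [Some (inl (i, false))] and [Some (inl (i, true))] are
   the vertices v_i and v'_i of the i-th triangle; [Some (inr j)] is the
   pendant vertex u_j. *)
Definition cactus_vertex (k t : nat) : finType := option ('I_k * bool + 'I_t)%type.

Definition cactus_adj (k t : nat) : rel (cactus_vertex k t) := fun x y =>
  match x, y with
  | None, Some _ | Some _, None => true
  | Some (inl (i, b)), Some (inl (j, c)) => (i == j) && (b != c)
  | _, _ => false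
  end.

Lemma cactus_adj_sym (k t : nat) : symmetric (@cactus_adj k t).
Proof.
by move=> [[[i b]|j]|] [[[i' b']|j']|] //=; rewrite eq_sym (eq_sym b).
Qed.

Lemma cactus_adj_irr (k t : nat) : irreflexive (@cactus_adj k t).
Proof. by move=> [[[i b]|j]|] //=; rewrite !eqxx. Qed.

Definition cactus (k t : nat) : sgraph :=
  SGraph (@cactus_adj_sym k t) (@cactus_adj_irr k t).

Lemma card_cactus (k t : nat) : #|cactus k t| = (2 * k + t + 1)%N.
Proof.
by rewrite card_option card_sum card_prod card_bool !card_ord mulnC addn1.
Qed.

(* The variable 'X plays the role of lambda. *)
Definition f_poly (R : realType) (n t : nat) (a : R) : {poly R} :=
  (a%:P - 'X) ^+ 3
  + (n%:R * a - 2 * a + 1) *: (a%:P - 'X) ^+ 2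
  + ((1 - n%:R) * a ^+ 2 + (3 * n%:R - 4) * a + 1 - n%:R) *: (a%:P - 'X)
  - (t%:R * (1 - a) ^+ 2)%:P.

(* A real matrix or polynomial seen over the complex numbers, so that its
   eigenvalues or roots range over all of R[i]. *)
Definition cplx_eigenvalue (R : realType) (m : nat) (A : 'M[R]_m) (z : R[i]) :
  bool := eigenvalue (map_mx (real_complex R) A) z.

Definition cplx_root (R : realType) (p : {poly R}) (z : R[i]) : bool :=
  root (map_poly (real_complex R) p) z.

(* Main.v *)
(* Eigenvectors are functions [u] on the vertices with
   [z u(x) = sum_(y ~ x) (a u(x) + (1 - a) u(y))]; this form avoids the degrees.
   On a triangle, [u(v_i) - u(v'_i)] is killed by [z - (3a - 1)]. Otherwise [u]
   is symmetric on the triangles and every value is determined by [u(v)] through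
   [(z - (a + 1)) u(v_i) = (1 - a) u(v) = (z - a) u(u_j)], unless [z] is [a] or
   [a + 1]; eliminating in the equation at the hub [v] gives the cubic. At
   [z = a] with [t = 0], and at [z = a + 1] with [k = 0], the elimination
   multiplied by a spurious factor, so the genuine condition there is that the
   root be multiple. *)
Require Import Defs.
From HB Require Import structures.
From mathcomp Require Import all_boot all_order all_algebra.
From mathcomp Require Import reals complex zify ring.
Set Implicit Arguments.
Unset Strict Implicit.
Unset Printing Implicit Defensive.
Import Order.TTheory GRing.Theory Num.Theory.
Local Open Scope ring_scope.

(** Transfers an equation to another with the same difference of sides, a goal that [ring] can
    close. *)
Lemma eq_by_sub (V : zmodType) (x y x' y' : V) :
  x = y -> x' - y' = x - y -> x' = y'.
Proof. by move=> -> /eqP; rewrite subrr subr_eq0 => /eqP. Qed.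

(** * Eigenvectors as functions on the vertices *)

Definition A_alpha_eigenfun (F : fieldType) (G : sgraph) (a z : F)
    (u : G -> F) :=
  (exists x, u x != 0) /\
  forall x, z * u x = \sum_(y | adj x y) (a * u x + (1 - a) * u y).

Lemma cplx_eigenvalue_A_alphaP (R : realType) (G : sgraph) (a : R) (z : R[i]) :
  cplx_eigenvalue (A_alpha G a) z <->
  exists u : G -> R[i], A_alpha_eigenfun (real_complex R a) z u.
Proof.
set M := map_mx (real_complex R) (A_alpha G a).
have ME (v : 'rV_#|G|) x : (v *m M) 0 (enum_rank x) =
    \sum_(y | adj x y) (real_complex R a * v 0 (enum_rank x)
      + (1 - real_complex R a) * v 0 (enum_rank y)).
  rewrite mxE big_split /= sumr_const -mulr_natr.
  (* Symmetry of [adj] turns column [x] of [M] into a sum over the neighbours of [x]; the diagonal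
     entry [a * deg x] supplies one copy of [a] per neighbour. *)
  have -> : \sum_j v 0 j * M j (enum_rank x) =
      \sum_j (v 0 j * (real_complex R a * ((deg x)%:R *+ (j == enum_rank x)))
        + v 0 j * ((1 - real_complex R a) * (adj x (enum_val j))%:R)).
    apply: eq_bigr => j _; rewrite !mxE enum_rankK adj_sym.
    rewrite rmorphD !rmorphM rmorphB rmorphMn !rmorph_nat rmorph1 -mulrDr.
    by case: eqP => [->|_] //=; rewrite enum_rankK.
  rewrite big_split /=; congr (_ + _).
    rewrite (bigD1 (enum_rank x)) //= eqxx big1 ?addr0 => [|j /negbTE->].
      by rewrite mulr1n mulrA [v _ _ * _]mulrC /deg cardsE.
    by rewrite !mulr0.
  rewrite [RHS]big_mkcond (reindex_onto enum_rank enum_val) /=; last first.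
    by move=> j _; rewrite enum_valK.
  rewrite (eq_bigl xpredT) => [|y]; last by rewrite enum_rankK eqxx.
  apply: eq_bigr => y _; rewrite enum_rankK.
  by case: adj; rewrite ?mulr1 ?mulr0 // mulrC.
split=> [/eigenvalueP[v vM nz_v] | [u [[x nz_u] uE]]].
  exists (fun x => v 0 (enum_rank x)); split=> [|x]; last by rewrite -ME vM mxE.
  by have [j vj] := rV0Pn _ nz_v; exists (enum_val j); rewrite enum_valK.
apply/eigenvalueP; exists (\row_j u (enum_val j)); last first.
  by apply/rV0Pn; exists (enum_rank x); rewrite mxE enum_rankK.
apply/rowP => j; rewrite -(enum_valK j) ME !mxE enum_rankK uE.
by apply: eq_bigr => y _; rewrite mxE enum_rankK.
Qed.

Lemma sum_indicator (R : nzSemiRingType) (I : finType) (i0 : I) :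
  \sum_i ((i == i0)%:R : R) = 1.
Proof. by rewrite (bigD1 i0) //= eqxx big1 ?addr0 // => i /negbTE->. Qed.

(** * Eigenvalue equations of the cactus and their elimination polynomial *)

Section Cactus.

Variables (F : numFieldType) (k t : nat) (a z : F).

(** A pendant vertex has one neighbour, a triangle vertex two and the hub [2 * k + t]; the multiples
    of [a * u x] are moved to the left. *)
Lemma cactus_eigenfun_eqs (u : cactus k t -> F) :
  (forall x, z * u x = \sum_(y | adj x y) (a * u x + (1 - a) * u y)) <->
  [/\ forall j, (z - a) * u (Some (inr j)) = (1 - a) * u None,
      forall i c, (z - 2 * a) * u (Some (inl (i, c))) =
        (1 - a) * (u None + u (Some (inl (i, ~~ c)))) &
      (z - (2 * k + t)%:R * a) * u None =
        (1 - a) * (\sum_i (u (Some (inl (i, false))) + u (Some (inl (i, true))))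
          + \sum_j u (Some (inr j)))].
Proof.
have nbr_pendant (E : cactus k t -> F) j :
    \sum_(y | adj (Some (inr j) : cactus k t) y) E y = E None.
  by apply: big_pred1 => -[[[i c]|j']|].
have nbr_triangle (E : cactus k t -> F) i c :
    \sum_(y | adj (Some (inl (i, c)) : cactus k t) y) E y =
    E None + E (Some (inl (i, ~~ c))).
  rewrite (bigD1 None) //=; congr (_ + _).
  apply: big_pred1 => -[[[i' c']|j]|] //=.
  rewrite andbT -!/(_ == _); apply/andP/eqP => [[/eqP-> ]|[-> ->]].
    by case: c c' => -[].
  by rewrite eqxx; case: c.
have nbr_hub (E : cactus k t -> F) :
    \sum_(y | adj (None : cactus k t) y) E y =
    \sum_i (E (Some (inl (i, false))) + E (Some (inl (i, true))))
      + \sum_j E (Some (inr j)).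
  rewrite (reindex_omap Some id) => [|[]] //=.
  rewrite (eq_bigl xpredT) => [|y]; last by rewrite eqxx.
  rewrite big_sumType /=; congr (_ + _).
  rewrite (eq_bigr (fun i => \sum_b E (Some (inl (i, b))))) => [|i _].
    by rewrite pair_bigA; apply: eq_bigr => -[].
  by rewrite big_bool addrC.
split=> [uE | [eq_pendant eq_triangle eq_hub] [[[i c]|j]|]].
- split=> [j|i c|].
  + have := uE (Some (inr j)); rewrite nbr_pendant => zu.
    by apply: (eq_by_sub zu); ring.
  + have := uE (Some (inl (i, c))); rewrite nbr_triangle => zu.
    by apply: (eq_by_sub zu); ring.
  + have := uE None; rewrite nbr_hub !big_split /= !sumr_const !card_ord.
    by rewrite -!mulr_sumr => zu; apply: (eq_by_sub zu); ring.
- by rewrite nbr_triangle; apply: (eq_by_sub (eq_triangle i c)); ring.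
- by rewrite nbr_pendant; apply: (eq_by_sub (eq_pendant j)); ring.
- rewrite nbr_hub !big_split /= !sumr_const !card_ord -!mulr_sumr.
  move: eq_hub; rewrite big_split /= => eq_hub.
  by apply: (eq_by_sub eq_hub); ring.
Qed.

(* The elimination determinant of the hub equation, i.e. [- f] (map_f_poly). *)
Definition hub_poly : {poly F} :=
  ('X - ((2 * k + t)%:R * a)%:P) * ('X - a%:P) * ('X - (a + 1)%:P)
  - ((1 - a) ^+ 2)%:P
    * ((2 * k)%:R%:P * ('X - a%:P) + t%:R%:P * ('X - (a + 1)%:P)).

Lemma horner_hub_poly : hub_poly.[z] =
  (z - (2 * k + t)%:R * a) * (z - a) * (z - (a + 1))
  - (1 - a) ^+ 2 * ((2 * k)%:R * (z - a) + t%:R * (z - (a + 1))).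
Proof. by rewrite /hub_poly !hornerE. Qed.

Lemma horner_deriv_hub_poly : hub_poly^`().[z] =
  (z - a) * (z - (a + 1))
  + (z - (2 * k + t)%:R * a) * ((z - a) + (z - (a + 1)))
  - (1 - a) ^+ 2 * (2 * k + t)%:R.
Proof. by rewrite /hub_poly !derivE !hornerE /=; ring. Qed.

Definition cactus_eigenvalue_cond :=
  (2 <= t)%N /\ z = a
  \/ (2 <= k)%N /\ z = a + 1
  \/ (1 <= k)%N /\ z = 3 * a - 1
  \/ root hub_poly z
     /\ (t = 0%N /\ z = a \/ k = 0%N /\ z = a + 1 -> root hub_poly^`() z).

(** * Every eigenvalue satisfies the condition *)

Lemma cactus_eigenfun_cond (u : cactus k t -> F) :
  A_alpha_eigenfun a z u -> cactus_eigenvalue_cond.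
Proof.
move=> [[x0 nz_u] /cactus_eigenfun_eqs[eq_pendant eq_triangle eq_hub]].
have [[k_gt0 z_a3]|twin] : ((1 <= k)%N /\ z = 3 * a - 1) \/
    forall i, u (Some (inl (i, false))) = u (Some (inl (i, true))).
- have [->|z_a3] := eqVneq z (3 * a - 1).
    (* If [k = 0], the symmetry on triangles is vacuous. *)
    by case: posnP => [k0|]; [right=> i; have := ltn_ord i; rewrite {2}k0|left].
  right=> i; apply/eqP.
  suff /eqP : (z - (3 * a - 1)) *
      (u (Some (inl (i, false))) - u (Some (inl (i, true)))) = 0.
    by rewrite mulf_eq0 !subr_eq0 (negbTE z_a3).
  have := congr2 (fun x y => x - y) (eq_triangle i false) (eq_triangle i true).
  by move=> e; apply: (eq_by_sub e); rewrite /=; ring.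
- by right; right; left.
have {}eq_triangle i :
    (z - (a + 1)) * u (Some (inl (i, false))) = (1 - a) * u None.
  by apply: (eq_by_sub (eq_triangle i false)); rewrite /= -twin; ring.
pose SX := \sum_i u (Some (inl (i, false))); pose SY := \sum_j u (Some (inr j)).
set h := u None in eq_pendant eq_triangle eq_hub.
have {}eq_hub : (z - (2 * k + t)%:R * a) * h = (1 - a) * (2 * SX + SY).
  rewrite eq_hub (eq_bigr (fun i => 2 * u (Some (inl (i, false))))) => [|i _].
    by rewrite -mulr_sumr.
  by rewrite -twin; ring.
have eq_SX : (z - (a + 1)) * SX = k%:R * ((1 - a) * h).
  rewrite mulr_sumr (eq_bigr _ (fun i _ => eq_triangle i)).
  by rewrite sumr_const card_ord mulr_natl.
have eq_SY : (z - a) * SY = t%:R * ((1 - a) * h).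
  rewrite mulr_sumr (eq_bigr _ (fun j _ => eq_pendant j)).
  by rewrite sumr_const card_ord mulr_natl.
have [h0 | nz_h] := eqVneq h 0; last first.
  right; right; right; split=> [|[[t0 za]|[k0 za]]].
  - suff /eqP : hub_poly.[z] * h = 0 by rewrite mulf_eq0 (negbTE nz_h) orbF.
    rewrite horner_hub_poly.
    (* The hub equation times both factors, so that [eq_SX] and [eq_SY] eliminate the two sums. *)
    transitivity ((z - a) * (z - (a + 1)) * ((z - (2 * k + t)%:R * a) * h)
      - (1 - a) * (2 * (z - a) * (k%:R * ((1 - a) * h))
                   + (z - (a + 1)) * (t%:R * ((1 - a) * h)))); first by ring.
    by rewrite eq_hub -eq_SX -eq_SY; ring.
  - suff /eqP : hub_poly^`().[z] * h = 0 by rewrite mulf_eq0 (negbTE nz_h) orbF.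
    have SY0 : SY = 0 by rewrite /SY big1 // => j _; have := ltn_ord j; lia.
    rewrite horner_deriv_hub_poly.
    (* At [z = a] the factor [z - (a + 1)] is [-1], so the derivative times [h] is minus the hub
       equation with [SX] eliminated. *)
    transitivity (- ((z - (2 * k + t)%:R * a) * h)
      - 2 * (1 - a) * (k%:R * ((1 - a) * h))); first by rewrite t0 za; ring.
    by rewrite eq_hub -eq_SX SY0 za; ring.
  - suff /eqP : hub_poly^`().[z] * h = 0 by rewrite mulf_eq0 (negbTE nz_h) orbF.
    have SX0 : SX = 0 by rewrite /SX big1 // => i _; have := ltn_ord i; lia.
    rewrite horner_deriv_hub_poly.
    transitivity ((z - (2 * k + t)%:R * a) * h
      - (1 - a) * (t%:R * ((1 - a) * h))); first by rewrite k0 za; ring.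
    by rewrite eq_hub -eq_SY SX0 za; ring.
rewrite h0 !mulr0 in eq_hub eq_SX eq_SY.
case: x0 nz_u => [[[i c]|j]|]; last by rewrite -/h h0 eqxx.
- have -> : u (Some (inl (i, c))) = u (Some (inl (i, false))).
    by case: c => //; rewrite twin.
  move=> nz_X; have /eqP := eq_triangle i.
  rewrite h0 mulr0 mulf_eq0 (negbTE nz_X) orbF subr_eq0 => /eqP za.
  (* With a single triangle [SX] is one nonzero value, so the hub equation forces [1 - a = 0], and
     then [z = a + 1] is a root of [hub_poly]. A single pendant vertex is treated alike below. *)
  have [k_le1|] := leqP k 1; last by right; left.
  have SXE : SX = u (Some (inl (i, false))).
    rewrite /SX (bigD1 i) //= big1 ?addr0 // => j /eqP[].
    by apply: val_inj => /=; have := ltn_ord i; have := ltn_ord j; lia.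
  have SY0 : SY = 0 by rewrite -eq_SY za; ring.
  move/esym/eqP: eq_hub; rewrite SY0 SXE addr0 !mulf_eq0 (negbTE nz_X) orbF.
  rewrite pnatr_eq0 orbF => /eqP b0.
  right; right; right; split=> [|[[_ /eqP]|[k0]]].
  - by rewrite /root horner_hub_poly b0 za; apply/eqP; ring.
  - by rewrite za -subr_eq0 addrC addKr oner_eq0.
  - by have := ltn_ord i; lia.
- move=> nz_Y; have /eqP := eq_pendant j.
  rewrite h0 mulr0 mulf_eq0 (negbTE nz_Y) orbF subr_eq0 => /eqP za.
  have [t_le1|] := leqP t 1; last by left.
  have SYE : SY = u (Some (inr j)).
    rewrite /SY (bigD1 j) //= big1 ?addr0 // => j' /eqP[].
    by apply: val_inj => /=; have := ltn_ord j; have := ltn_ord j'; lia.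
  have SX0 : SX = 0.
    by apply: oppr_inj; rewrite oppr0 -eq_SX za; ring.
  move/esym/eqP: eq_hub; rewrite SYE SX0 mulr0 add0r mulf_eq0 (negbTE nz_Y) orbF.
  move=> /eqP b0.
  right; right; right; split=> [|[[t0 _]|[_ /eqP]]].
  - by rewrite /root horner_hub_poly b0 za; apply/eqP; ring.
  - by have := ltn_ord j; lia.
  - by rewrite za eq_sym -subr_eq0 addrC addKr oner_eq0.
Qed.

(** * Eigenfunctions for each value allowed by the condition *)

Definition cactus_fun (h : F) (X : 'I_k -> bool -> F) (Y : 'I_t -> F)
    (x : cactus k t) : F :=
  match x with
  | None => h
  | Some (inl (i, c)) => X i c
  | Some (inr j) => Y j
  end.

(* The guards [0 < t] and [0 < k] matter: without pendant edges (or triangles)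
   the corresponding equation is absent. *)
Lemma const_cactus_eigenfun (h X Y : F) :
  [|| h != 0, (0 < k)%N && (X != 0) | (0 < t)%N && (Y != 0)] ->
  ((0 < t)%N -> (z - a) * Y = (1 - a) * h) ->
  ((0 < k)%N -> (z - (a + 1)) * X = (1 - a) * h) ->
  (z - (2 * k + t)%:R * a) * h = (1 - a) * (2 * k%:R * X + t%:R * Y) ->
  exists u : cactus k t -> F, A_alpha_eigenfun a z u.
Proof.
move=> nz eq_Y eq_X eq_h; exists (cactus_fun h (fun _ _ => X) (fun _ => Y)).
split.
  case/or3P: nz => [nz_h | /andP[k_gt0 nz_X] | /andP[t_gt0 nz_Y]].
  - by exists None.
  - by exists (Some (inl (Ordinal k_gt0, true))).
  - by exists (Some (inr (Ordinal t_gt0))).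
apply/cactus_eigenfun_eqs; split=> [j|i c|] /=.
- by apply: eq_Y; have := ltn_ord j; lia.
- have /eq_X e : (0 < k)%N by have := ltn_ord i; lia.
  by apply: (eq_by_sub e); ring.
- by rewrite eq_h big_split /= !sumr_const !card_ord; ring.
Qed.

Lemma cactus_eigenfun_exists :
  cactus_eigenvalue_cond -> exists u : cactus k t -> F, A_alpha_eigenfun a z u.
Proof.
have nz2 : 2 != 0 :> F by rewrite pnatr_eq0.
case=> [[t_ge2 za]|[[k_ge2 za]|[[k_gt0 za]|[rP rP']]]].
- pose j0 : 'I_t := Ordinal (ltnW t_ge2); pose j1 : 'I_t := Ordinal t_ge2.
  pose Y j : F := (j == j0)%:R - (j == j1)%:R.
  exists (cactus_fun 0 (fun _ _ => 0) Y); split.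
    by exists (Some (inr j0)); rewrite /= /Y eqxx subr0 oner_eq0.
  apply/cactus_eigenfun_eqs; split=> [j|i c|] /=.
  + by rewrite za; ring.
  + by ring.
  + by rewrite big1 /Y ?sumrB ?sum_indicator => [|i _]; ring.
- pose i0 : 'I_k := Ordinal (ltnW k_ge2); pose i1 : 'I_k := Ordinal k_ge2.
  pose X i (c : bool) : F := (i == i0)%:R - (i == i1)%:R.
  exists (cactus_fun 0 X (fun=> 0)); split.
    by exists (Some (inl (i0, true))); rewrite /= /X eqxx subr0 oner_eq0.
  apply/cactus_eigenfun_eqs; split=> [j|i c|] /=.
  + by ring.
  + by rewrite za /X; ring.
  + by rewrite big_split /= /X !sumrB !sum_indicator big1 //; ring.
- pose i0 : 'I_k := Ordinal k_gt0.
  (* Opposite values on the two twins of one triangle cancel in the hub equation. *)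
  pose X i (c : bool) : F := (i == i0)%:R * (-1) ^+ c.
  exists (cactus_fun 0 X (fun=> 0)); split.
    by exists (Some (inl (i0, false))); rewrite /= /X eqxx mulr1 oner_eq0.
  apply/cactus_eigenfun_eqs; split=> [j|i c|] /=.
  + by ring.
  + by rewrite za /X; case: c => /=; ring.
  + rewrite !big1 ?addr0 ?mulr0 // => i _.
    by rewrite /X; ring.
move/eqP: rP; rewrite horner_hub_poly => rP.
(* At [z = a] and [z = a + 1] the value of [hub_poly] is [(1 - a) ^+ 2] times [t] and [- 2 * k]
   respectively. If that count is positive then [1 - a = 0], and the hub decouples from the other
   vertices. *)
have b_eq0 m : (0 < m)%N -> (1 - a) ^+ 2 * m%:R = 0 -> 1 - a = 0.
  move=> m_gt0 /eqP; rewrite mulf_eq0 expf_eq0 pnatr_eq0 /=.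
  by rewrite (gtn_eqF m_gt0) orbF => /eqP.
have [za | nz_za] := eqVneq z a.
  have [t0 | t_gt0] := posnP t.
    have /rP'/eqP : t = 0%N /\ z = a \/ k = 0%N /\ z = a + 1 by left.
    rewrite horner_deriv_hub_poly => {}rP'.
    (* The triangle equation at [z = a] reads [- X = (1 - a) * h]; the hub equation is then the
       vanishing of the derivative. *)
    apply: (@const_cactus_eigenfun 1 (- (1 - a)) 0); rewrite ?oner_neq0 ?t0 //.
      by rewrite za => _; ring.
    by apply/esym/(eq_by_sub rP'); rewrite t0 za; ring.
  have b0 : 1 - a = 0.
    by apply: (b_eq0 t t_gt0); apply: (eq_by_sub rP); rewrite za; ring.
  apply: (@const_cactus_eigenfun 0 0 1); rewrite ?b0 ?za => *; try ring.
  by rewrite t_gt0 oner_neq0 !orbT.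
have [za1 | nz_za1] := eqVneq z (a + 1).
  have [k0 | k_gt0] := posnP k.
    have /rP'/eqP : t = 0%N /\ z = a \/ k = 0%N /\ z = a + 1 by right.
    rewrite horner_deriv_hub_poly => {}rP'.
    apply: (@const_cactus_eigenfun 1 0 (1 - a)); rewrite ?oner_neq0 ?k0 //.
      by rewrite za1 => _; ring.
    by apply: (eq_by_sub rP'); rewrite k0 za1; ring.
  have b0 : 1 - a = 0.
    apply: (b_eq0 (2 * k)%N); first by rewrite muln_gt0.
    by apply/esym/(eq_by_sub rP); rewrite za1; ring.
  apply: (@const_cactus_eigenfun 0 1 0); rewrite ?b0 ?za1 => *; try ring.
  by rewrite k_gt0 oner_neq0 !orbT.
(* The solution of the triangle and pendant equations with denominators cleared; the hub value is
   nonzero since [z] is neither [a] nor [a + 1]. *)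
apply: (@const_cactus_eigenfun ((z - a) * (z - (a + 1)))
  ((1 - a) * (z - a)) ((1 - a) * (z - (a + 1)))) => [| _ | _ |]; try ring.
  by rewrite mulf_neq0 ?subr_eq0.
by apply: (eq_by_sub rP); ring.
Qed.

End Cactus.

(** * Transfer to [f_poly] and the complex spectrum *)

Lemma map_f_poly (R : realType) (k t : nat) (a : R) :
  map_poly (real_complex R) (f_poly (2 * k + t + 1) t a) =
  - hub_poly k t (real_complex R a).
Proof.
rewrite /f_poly /hub_poly -!mul_polyC.
rewrite !(rmorphD, rmorphB, rmorphM, rmorphXn, rmorphN) /=.
rewrite !map_polyC map_polyX /=.
rewrite !(rmorphD, rmorphB, rmorphM, rmorphXn, rmorphN, rmorph1, rmorph_nat) /=.
ring.
Qed.

Theorem theorem8 (R : realType) (k t n : nat) (a : R)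
    (hn : n = (2 * k + t + 1)%N) (ha : 0 <= a <= 1) :
  ((1 <= k)%N -> (2 <= t)%N -> forall z : R[i],
     cplx_eigenvalue (A_alpha (cactus k t) a) z <->
       z = real_complex R a
       \/ (2 <= k)%N /\ z = real_complex R (a + 1)
       \/ z = real_complex R (3 * a - 1)
       \/ cplx_root (f_poly n t a) z)
  /\
  (forall z : R[i],
     cplx_eigenvalue (A_alpha (cactus k t) a) z <->
       (2 <= t)%N /\ z = real_complex R a
       \/ (2 <= k)%N /\ z = real_complex R (a + 1)
       \/ (1 <= k)%N /\ z = real_complex R (3 * a - 1)
       \/ cplx_root (f_poly n t a) z
          /\ (t = 0%N /\ z = real_complex R a
              \/ k = 0%N /\ z = real_complex R (a + 1) ->
              cplx_root (f_poly n t a)^`() z)).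
Proof.
set general := (X in _ /\ X).
(* For [1 <= k] and [2 <= t] the guards on [t] and [k] hold and the derivative clause is vacuous, so
   the first claim is a case of the general one. *)
suff hgeneral : general.
  split=> // k_gt0 t_gt1 z; split=> [/hgeneral|].
    by case=> [[_ ->]|[?|[[_ ->]|[? _]]]]; tauto.
  move=> cases; apply/hgeneral; case: cases => [->|[?|[->|?]]]; try tauto.
  by right; right; right; split=> // -[[]|[]]; lia.
move=> z; apply: (iff_trans (cplx_eigenvalue_A_alphaP _ a z)).
rewrite hn /cplx_root -deriv_map map_f_poly derivN !rootN.
have -> : real_complex R (a + 1) = real_complex R a + 1 by rewrite rmorphD rmorph1.
have -> : real_complex R (3 * a - 1) = 3 * real_complex R a - 1.
  by rewrite rmorphB rmorphM rmorph1 rmorph_nat.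
split=> [[u uP]|]; first exact: (cactus_eigenfun_cond uP).
exact: cactus_eigenfun_exists.
Qed.
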